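(* For arbitrary $y\in\mathbb{R}$, $a_1,a_2,\dots,a_n\in\mathbb{R}$ and an integer $n\ge 0$, $$y^n+\sum_{i=1}^n\;\sum_{1\le t_1<t_2<\cdots<t_i\le n}(-1)^i\,(y+a_{t_1}+\cdots+a_{t_i})^n=(-1)^n\,n!\,a_1a_2\cdots a_n ,$$ or equivalently, $$\sum_{i=1}^n\;\sum_{1\le t_1<t_2<\cdots<t_i\le n}(-1)^i\,(a_{t_1}+\cdots+a_{t_i})^k=\begin{cases}-1, & \text{if } k=0,\\ 0, & \text{if } k=1,\dots,n-1,\\ (-1)^n\,n!\,a_1a_2\cdots a_n, & \text{if } k=n.\end{cases}$$
   Context: The inner sums run over all integers $t_1,\dots,t_i$ with $1\le t_1<t_2<\cdots<t_i\le n$. Convention: $0^0=1$.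
   Formalization: The second identity is taken for n ≥ 1 only: for n = 0 and k = 0 its left side is the empty sum 0, while the cases k = 0 and k = n demand both −1 and 1. *)

(* Defs.v *)
From mathcomp Require Export all_boot all_order all_algebra.
From mathcomp Require Export reals.

(* Main.v *)
Require Import Defs.
From mathcomp Require Import all_boot all_order all_algebra.
From mathcomp Require Import reals.
From mathcomp Require Import ring.
Import Order.TTheory GRing.Theory Num.Theory.
Local Open Scope ring_scope.

(** Adjoining the empty choice of indices, with term [y ^+ k], turns the sum
    over increasing tuples into the alternating sum of
    [(y + \sum_(x in A) a x) ^+ k] over all subsets [A] of the index set
    ([sum_increasing_tuples_powerset]).  The latter is what one gets by
    expanding the composite of the operators [p(X) |-> p(X) - p(X + a_m)], one
    for each index [m], applied to [X ^ k] and evaluated at [y].  Each such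
    operator maps degree at most [d] to degree at most [d - 1] and multiplies
    the coefficient in degree [d] by [- d * a_m], which becomes the one in
    degree [d - 1] ([size_sub_shift_poly], [coef_sub_shift_poly]).  After [n]
    of them a polynomial of degree at most [n] has become a constant:
    [(-1)^n n!] times the product of the [a_m] times its coefficient of degree
    [n] ([sum_sign_subset_horner]).  For [X ^ k] that coefficient is [1] if
    [k = n] and [0] if [k < n], whatever [y] is.  The second form of the
    identity is the case [y = 0], where the empty choice contributes
    [0 ^+ k], that is [1] for [k = 0] and [0] otherwise. *)

(** * Differences of polynomials *)

Lemma coef_XaddC_exp (R : comNzRingType) (c : R) (i j : nat) :
  (('X + c%:P) ^+ i)`_j = c ^+ (i - j) *+ 'C(i, j).
Proof.
rewrite addrC exprDn coef_sum.
under eq_bigr => k _ do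
  rewrite coefMn -polyC_exp coefCM coefXn mulr_natr mulrb.
have [ji | ij] := ltnP j i.+1.
  rewrite (bigD1 (Ordinal ji)) //= eqxx big1 ?addr0 // => k neq.
  case: eqP => [e | _]; last by rewrite mul0rn.
  by case/eqP: neq; apply: val_inj.
rewrite bin_small // mulr0n big1 // => k _.
case: eqP => [e | _]; last by rewrite mul0rn.
by move: (ltn_ord k); rewrite -e ltnNge ij.
Qed.

Lemma coef_shift_poly (R : comNzRingType) (c : R) (p : {poly R}) (m j : nat) :
  (size p <= m)%N ->
  (p \Po ('X + c%:P))`_j = \sum_(i < m) p`_i * (c ^+ (i - j) *+ 'C(i, j)).
Proof.
move=> le_pm; rewrite coef_comp_poly.
rewrite (big_ord_widen _ (fun i => p`_i * (('X + c%:P) ^+ i)`_j) le_pm).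
rewrite big_mkcond; apply: eq_bigr => i _; rewrite coef_XaddC_exp.
by case: ltnP => // le_pi; rewrite nth_default // mul0r.
Qed.

(** The leading terms of [p(X)] and [p(X + c)] agree and cancel. *)
Lemma size_sub_shift_poly (R : comNzRingType) (c : R) (p : {poly R}) (m : nat) :
  (size p <= m.+1)%N -> (size (p - (p \Po ('X + c%:P)))%R <= m)%N.
Proof.
move=> le_p; apply/leq_sizeP => j le_mj.
rewrite coefB (coef_shift_poly _ _ _ _ j le_p) big_ord_recr /=.
rewrite big1 ?add0r => [|i _]; last first.
  by rewrite bin_small ?mulr0n ?mulr0 // (leq_trans (ltn_ord i)).
move: le_mj; rewrite leq_eqVlt => /orP[/eqP <- | lt_mj].
  by rewrite subnn expr0 binn mulr1 subrr.
by rewrite bin_small // mulr0 nth_default ?subr0 // (leq_trans le_p).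
Qed.

(** In degree [m] the binomial expansion of [(X + c) ^ m.+1] contributes
    [m.+1 * c], while the terms in [p`_m] cancel. *)
Lemma coef_sub_shift_poly (R : comNzRingType) (c : R) (p : {poly R}) (m : nat) :
  (size p <= m.+2)%N ->
  (p - (p \Po ('X + c%:P)))`_m = - (m.+1%:R * c * p`_m.+1).
Proof.
move=> le_p; rewrite coefB (coef_shift_poly _ _ _ _ m le_p) !big_ord_recr /=.
rewrite big1 ?add0r => [|i _]; last by rewrite bin_small ?mulr0n ?mulr0.
rewrite subnn binn subSnn binSn expr1 expr0 -mulr_natl; ring.
Qed.

(** * Alternating sums over subsets *)

Lemma big_subset_setU1 (V : nmodType) (I : finType) (x : I) (S : {set I})
    (F : {set I} -> V) :
  x \notin S ->
  \sum_(A : {set I} | A \subset x |: S) F A =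
  \sum_(A : {set I} | A \subset S) (F A + F (x |: A)).
Proof.
move=> xS; rewrite big_split (bigID (fun A : {set I} => x \in A)) /= addrC.
congr (_ + _).
  by apply: eq_bigl => A; rewrite -subsetD1 setU1K.
rewrite (reindex_onto (fun A => x |: A) (fun A => A :\ x)) => [|A /andP[_ xA]].
  apply: eq_bigl => A; rewrite setU11 andbT.
  apply/andP/idP => [[sAS /eqP <-]|sAS].
    by rewrite -(setU1K xS) setSD.
  split; first exact: setUS.
  by rewrite setU1K //; apply: contra xS; apply: (subsetP sAS).
exact: setD1K.
Qed.

(** Induction on [S]: grouping the subsets that differ only by [x] replaces [p]
    by [p(X) - p(X + a x)], which is why the statement is about arbitrary
    polynomials and not just powers of ['X]. *)
Lemma sum_sign_subset_horner (R : comNzRingType) (I : finType) (a : I -> R)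
    (S : {set I}) (p : {poly R}) (y : R) :
  (size p <= #|S|.+1)%N ->
  \sum_(A : {set I} | A \subset S)
     (-1) ^+ #|A| * p.[y + \sum_(x in A) a x]
  = (-1) ^+ #|S| * #|S|`!%:R * (\prod_(x in S) a x) * p`_#|S|.
Proof.
move: {2}#|S| (erefl #|S|) => m; elim: m S p => [|m IHm] S p cardS.
  move/cards0_eq: cardS => ->; rewrite cards0 => le_p.
  rewrite (big_pred1 set0) => [|A]; last by rewrite subset0.
  by rewrite cards0 !big_set0 addr0 (size1_polyC le_p) hornerC coefC !mul1r.
have /card_gt0P[x Sx]: (0 < #|S|)%N by rewrite cardS.
have x'S: x \notin S :\ x by rewrite setD11.
have cardS': #|S :\ x| = m.
  by move: cardS; rewrite (cardsD1 x S) Sx => -[].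
rewrite cardS => le_p.
rewrite -[in LHS](setD1K Sx) big_subset_setU1 //.
transitivity (\sum_(A : {set I} | A \subset S :\ x)
    (-1) ^+ #|A| * (p - (p \Po ('X + (a x)%:P))).[y + \sum_(z in A) a z]).
  apply: eq_bigr => A sA.
  have xA: x \notin A by apply: contra x'S; apply: (subsetP sA).
  rewrite cardsU1 xA big_setU1 //= hornerD hornerN horner_comp.
  rewrite hornerD hornerX hornerC exprS mulN1r mulNr mulrBr.
  by rewrite -addrA [a x + _]addrC.
rewrite IHm ?cardS' //; last exact: size_sub_shift_poly.
rewrite coef_sub_shift_poly // -[in RHS](setD1K Sx) big_setU1 //=.
rewrite factS natrM exprS; ring.
Qed.

(** * Increasing tuples as subsets *)

Lemma sorted_ltn_uniq (n : nat) (s : seq 'I_n) :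
  sorted ltn (map val s) -> uniq s.
Proof.
by move/(sorted_uniq ltn_trans ltnn); rewrite map_inj_uniq //; apply: val_inj.
Qed.

Lemma sum_sorted_tuples (V : nmodType) (n i : nat) (F : {set 'I_n} -> V) :
  \sum_(t : i.-tuple 'I_n | sorted ltn (map val t)) F [set x in t]
  = \sum_(A : {set 'I_n} | #|A| == i) F A.
Proof.
pose T := [set t : i.-tuple 'I_n | sorted ltn (map val t)].
pose h (t : i.-tuple 'I_n) := [set x in t].
have h_inj : {in T &, injective h}.
  move=> t u; rewrite !inE => st su /setP eq_tu.
  apply/val_inj/(inj_map val_inj).
  apply: (irr_sorted_eq ltn_trans ltnn) => //.
  by apply: eq_mem_map => x; have := eq_tu x; rewrite !inE.
transitivity (\sum_(t in T) F (h t)); first by apply: eq_bigl => t; rewrite inE.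
rewrite -(big_imset _ h_inj); apply: eq_bigl => A.
apply/imsetP/eqP => [[t] | cardA].
  rewrite inE => /sorted_ltn_uniq Ut ->.
  by rewrite cardsE (card_uniqP Ut) size_tuple.
have sz_A : size (enum A) == i by rewrite -cardE cardA.
exists (Tuple sz_A); last by apply/setP => x; rewrite !inE mem_enum.
rewrite inE /= {1}/enum_mem -enumT.
apply: (subseq_sorted ltn_trans (map_subseq _ (filter_subseq _ _))).
by rewrite val_enum_ord iota_ltn_sorted.
Qed.

(** The tuples in the theorem have length at least [1]; the term [y ^+ k]
    stands for the empty subset. *)
Lemma sum_increasing_tuples_powerset (R : comNzRingType) (n k : nat)
    (a : 'I_n -> R) (y : R) :
  y ^+ k
  + \sum_(1 <= i < n.+1) \sum_(t : i.-tuple 'I_n | sorted ltn (map val t))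
      (-1) ^+ i * (y + \sum_(j < i) a (tnth t j)) ^+ k
  = \sum_(A : {set 'I_n} | A \subset setT)
      (-1) ^+ #|A| * (y + \sum_(x in A) a x) ^+ k.
Proof.
pose F (A : {set 'I_n}) := (-1) ^+ #|A| * (y + \sum_(x in A) a x) ^+ k.
have card_lt (A : {set 'I_n}) : (#|A| < n.+1)%N.
  by rewrite ltnS -[leqRHS]card_ord max_card.
transitivity (\sum_(0 <= i < n.+1) \sum_(A : {set 'I_n} | #|A| == i) F A).
  rewrite [RHS]big_ltn //; congr (_ + _).
    rewrite (big_pred1 set0) => [|A]; last by rewrite cards_eq0.
    by rewrite /F cards0 big_set0 addr0 mul1r.
  apply: eq_bigr => i _; rewrite -sum_sorted_tuples.
  apply: eq_bigr => t /sorted_ltn_uniq Ut.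
  rewrite /F cardsE (card_uniqP Ut) size_tuple -(big_tuple _ _ t xpredT a).
  by rewrite (big_uniq _ Ut); under [in RHS]eq_bigl => x do rewrite inE.
rewrite big_mkord (partition_big (fun A => Ordinal (card_lt A)) xpredT) //=.
by apply: eq_bigr => i _; apply: eq_bigl => A; rewrite subsetT.
Qed.

(** * The identities *)

Lemma sum_sign_increasing_tuples_exp (R : comNzRingType) (n k : nat)
    (a : 'I_n -> R) (y : R) :
  (k <= n)%N ->
  y ^+ k
  + \sum_(1 <= i < n.+1) \sum_(t : i.-tuple 'I_n | sorted ltn (map val t))
      (-1) ^+ i * (y + \sum_(j < i) a (tnth t j)) ^+ k
  = (-1) ^+ n * n`!%:R * (\prod_(m < n) a m) *+ (k == n).
Proof.
move=> le_kn; rewrite sum_increasing_tuples_powerset.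
under eq_bigr => A _ do rewrite -[(y + _) ^+ k]hornerXn.
rewrite sum_sign_subset_horner cardsT card_ord ?size_polyXn //.
rewrite coefXn eq_sym -[RHS]mulr_natr.
by under eq_bigl => x do rewrite inE.
Qed.

Theorem theorem1p3 (R : realType) (n : nat) (a : 'I_n -> R) :
  (forall y : R,
     y ^+ n
     + \sum_(1 <= i < n.+1) \sum_(t : i.-tuple 'I_n | sorted ltn (map val t))
         (-1) ^+ i * (y + \sum_(j < i) a (tnth t j)) ^+ n
     = (-1) ^+ n * n`!%:R * \prod_(m < n) a m)
  /\
  ((1 <= n)%N -> forall k : nat, (k <= n)%N ->
     \sum_(1 <= i < n.+1) \sum_(t : i.-tuple 'I_n | sorted ltn (map val t))
       (-1) ^+ i * (\sum_(j < i) a (tnth t j)) ^+ k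
     = if k == 0%N then -1
       else if (k < n)%N then 0
       else (-1) ^+ n * n`!%:R * \prod_(m < n) a m).
Proof.
split=> [y | n_gt0 k le_kn].
  by rewrite sum_sign_increasing_tuples_exp // eqxx.
have := sum_sign_increasing_tuples_exp R n k a 0 le_kn.
under eq_bigr => i _ do under eq_bigr => t _ do rewrite add0r.
rewrite addrC => /(canRL (addrK _)) ->; rewrite expr0n.
have [-> | k_neq0] := eqVneq k 0%N.
  by rewrite (ltn_eqF n_gt0) mulr0n sub0r.
rewrite subr0 ltn_neqAle le_kn andbT.
by case: eqVneq.
Qed.
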